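(* Let $R_2$ be the digraph with one vertex and two edges (the two-leaf rose), and let $G$ be the digraph with two vertices $u,v$ and exactly three edges: $a$ from $u$ to $u$, $b$ from $u$ to $v$, and $c$ from $v$ to $u$ (the golden mean shift). Then $R_2$ and $G$ are strong UDAF equivalent but not shift equivalent.
   Context: $\mathbb N$ includes $0$. Shift equivalence: for a finite digraph $D$ let $(v,w)\operatorname{Adj}_D$ be the number of edges from $v$ to $w$. Viewing elements of $\mathbb Q^{V_D}$ as row vectors, let $K=\bigcap_{i\in\mathbb N}(\mathbb Q^{V_D})\operatorname{Adj}_D^i$, $\mathcal G_D=\{v\in\mathbb Q^{V_D}: v\operatorname{Adj}_D^i\in\mathbb Z^{V_D}\text{ for some }i\in\mathbb N\}\cap K$ and $\mathcal G_D^+=\{v\in\mathbb Q^{V_D}: v\operatorname{Adj}_D^i\in\mathbb N^{V_D}\text{ for some }i\in\mathbb N\}\cap K$, and $\hat\sigma_D:\mathcal G_D\to\mathcal G_D$, $(v)\hat\sigma_D=v\operatorname{Adj}_D$. Finite digraphs $D_1,D_2$ are shift equivalent if the triples $(\mathcal G_{D_i},\mathcal G_{D_i}^+,\hat\sigma_{D_i})$ are isomorphic (i.e. there is a group isomorphism $\mathcal G_{D_1}\to\mathcal G_{D_2}$ mapping $\mathcal G_{D_1}^+$ onto $\mathcal G_{D_2}^+$ and intertwining $\hat\sigma_{D_1}$ and $\hat\sigma_{D_2}$). Maps are written on the right of their arguments, and $p\circ q$ means first $p$, then $q$. A digraph $D=(V_D,E_D,s_D,t_D)$ consists of a vertex set,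 an edge set and functions $s_D,t_D:E_D\to V_D$; $e$ is an edge from $(e)s_D$ to $(e)t_D$. A digraph homomorphism $\phi:D_1\to D_2$ is a pair $(\phi_V,\phi_E)$ with $\phi_V:V_{D_1}\to V_{D_2}$, $\phi_E:E_{D_1}\to E_{D_2}$, $\phi_E s_{D_2}=s_{D_1}\phi_V$ and $\phi_E t_{D_2}=t_{D_1}\phi_V$; $\operatorname{Hom}(D_1,D_2)$ is the set of these. For $n\le m$ in $\mathbb Z\cup\{\pm\infty\}$, $\mathbb Z_{[n,m]}$ is the digraph with vertices $\{i\in\mathbb Z:n\le i\le m\}$ and one edge $(i,i+1)$ from $i$ to $i+1$ whenever $n\le i<i+1\le m$. $\operatorname{Walks}(D)$ is the category with object set $V_D$ whose morphisms are the finite walks, i.e. elements of $\bigcup_{0\le n<\infty}\operatorname{Hom}(\mathbb Z_{[0,n]},D)$ (an element $p$ of $\operatorname{Hom}(\mathbb Z_{[0,n]},D)$ has length $\|p\|=n$ and goes from $(0)p_V$ to $(n)p_V$), composed by concatenation. It is also regarded as a digraph (objects as vertices, morphisms as edges), and $D$ is identified with the subdigraph of walks of length $1$. A homomorphism $\phi:D_1\to\operatorname{Walks}(D_2)$ extends uniquely to a functor $\widetilde\phi:\operatorname{Walks}(D_1)\to\operatorname{Walks}(D_2)$. A generalised bi-infinite walk in $D$ is a homomorphism $w:\mathbb Z_{[-\infty,\infty]}\to\operatorname{Walks}(D)$; it is degenerate if $\|(n,n+1)w_E\|=0$ for all sufficiently large $n$, or for all sufficiently small $n$. A flattening of a non-degenerate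 $w$ is a $w_0\in\operatorname{Hom}(\mathbb Z_{[-\infty,\infty]},D)$ for which there is $f:\mathbb Z\to\mathbb Z$ such that for all $z\in\mathbb Z$ and $0\le j<\|(z,z+1)w_E\|$: $(z+1)f=(z)f+\|(z,z+1)w_E\|$ and $((z)f+j,(z)f+j+1)(w_0)_E=(j,j+1)((z,z+1)w_E)_E$ (the first equality being required for all $z$). Two non-degenerate generalised bi-infinite walks are equivalent if they have the same set of flattenings; the classes $[w]$ are called routes and $\operatorname{Route}(D)$ is the set of routes of non-degenerate generalised bi-infinite walks in $D$. For finite $D_1,D_2$, a homomorphism $\phi:D_1\to\operatorname{Walks}(D_2)$ is degenerate if $p\circ\widetilde\phi$ is degenerate for some non-degenerate generalised bi-infinite walk $p$ in $D_1$. If $\phi$ is non-degenerate, $\phi_*:\operatorname{Route}(D_1)\to\operatorname{Route}(D_2)$ is $[p]\mapsto[p\circ\widetilde\phi]$. A UDAF digraph is a finite digraph $D$ such that for every $v\in V_D$ the number of $h\in\operatorname{Hom}(\mathbb Z_{[0,\infty]},D)$ with $(0)h_V=v$ is not equal to $1$, and the number of $h\in\operatorname{Hom}(\mathbb Z_{[-\infty,0]},D)$ with $(0)h_V=v$ is not equal to $1$. A UDAF folding is a (non-degenerate) homomorphism $\phi:D_1\to\operatorname{Walks}(D_2)$ such that $\phi_*$ is a bijection (homomorphisms $D_1\to D_2$ are included via $D_2\subseteq\operatorname{Walks}(D_2)$). UDAFG is the smallest category whose objects are the pairs $(\operatorname{Route}(D),D)$ with $D$ a UDAF digraph, in which every $\phi_*$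 (for $\phi:D_1\to\operatorname{Walks}(D_2)$ a UDAF folding of UDAF digraphs) is a morphism $(\operatorname{Route}(D_1),D_1)\to(\operatorname{Route}(D_2),D_2)$, and which is closed under composition and inversion of bijections. UDAF digraphs $D_1,D_2$ are strong UDAF equivalent if $(\operatorname{Route}(D_1),D_1)$ and $(\operatorname{Route}(D_2),D_2)$ are isomorphic in UDAFG. *)

(* Defs.v *)
From HB Require Import structures.
From mathcomp Require Import all_boot all_order all_algebra.
From mathcomp Require Import boolp classical_sets functions.

Set Implicit Arguments.
Unset Strict Implicit.
Unset Printing Implicit Defensive.

Import Order.TTheory GRing.Theory Num.Theory.
Local Open Scope classical_set_scope.
Local Open Scope ring_scope.

(** * Digraphs and homomorphisms *)

Record digraph := Digraph {
  vert : Type;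
  edge : Type;
  src : edge -> vert;
  tgt : edge -> vert }.

Record hom (D1 D2 : digraph) := Hom {
  hV : vert D1 -> vert D2;
  hE : edge D1 -> edge D2;
  hom_src : forall e, src (hE e) = hV (src e);
  hom_tgt : forall e, tgt (hE e) = hV (tgt e) }.

Record finDigraph := FinDigraph {
  fvert : finType;
  fedge : finType;
  fsrc : fedge -> fvert;
  ftgt : fedge -> fvert }.

Definition digraph_of (D : finDigraph) : digraph :=
  @Digraph (fvert D) (fedge D) (@fsrc D) (@ftgt D).
Coercion digraph_of : finDigraph >-> digraph.

(** The digraphs Z_[-oo,oo], Z_[0,oo] and Z_[-oo,0].  In the first two, the
    number [i] as an edge stands for the edge (i, i+1). *)

Definition Zline : digraph := @Digraph int int (fun i => i) (fun i => i + 1).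

Definition Zge0 : digraph := @Digraph nat nat (fun i => i) (fun i => i.+1).

(** Here [i : nat] stands for the vertex -i, and for the edge (-(i+1), -i). *)
Definition Zle0 : digraph := @Digraph nat nat (fun i => i.+1) (fun i => i).

(** * Finite walks

    A homomorphism from Z_[0,n] to D is represented by its initial vertex
    (which is not determined by the edges when n = 0) together with the list of
    its n successive edges. *)

Fixpoint is_walk (D : finDigraph) (v : fvert D) (s : seq (fedge D)) : bool :=
  if s is e :: s' then (fsrc e == v) && is_walk (ftgt e) s' else true.

Definition walk (D : finDigraph) : Type :=
  {p : fvert D * seq (fedge D) | is_walk p.1 p.2}.

Section Walk.
Variable D : finDigraph.
Implicit Types (p q : walk D) (v : fvert D) (s : seq (fedge D)).

Definition wedges p : seq (fedge D) := (sval p).2.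
Definition wsrc p : fvert D := (sval p).1.
Definition wtgt p : fvert D := last (wsrc p) (map (@ftgt D) (wedges p)).
Definition wlen p : nat := size (wedges p).

Lemma is_walk_cat v s1 s2 :
  is_walk v (s1 ++ s2) = is_walk v s1 && is_walk (last v (map (@ftgt D) s1)) s2.
Proof. by elim: s1 v => [|e s1 IH] v //=; rewrite IH andbA. Qed.

Definition walk_id v : walk D := exist _ (v, [::]) isT.

Lemma walk_edge_subproof (e : fedge D) : is_walk (fsrc e) [:: e].
Proof. by rewrite /= eqxx. Qed.

Definition walk_edge (e : fedge D) : walk D :=
  exist _ (fsrc e, [:: e]) (walk_edge_subproof e).

Lemma walk_comp_subproof p q :
  wtgt p = wsrc q -> is_walk (wsrc p) (wedges p ++ wedges q).
Proof.
move=> h; rewrite is_walk_cat (valP p) /= -/(wtgt p) h; exact: (valP q).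
Qed.

Definition walk_comp p q (h : wtgt p = wsrc q) : walk D :=
  exist _ (wsrc p, wedges p ++ wedges q) (walk_comp_subproof h).

End Walk.

(** The category Walks(D), regarded as a digraph. *)
Definition Walks (D : finDigraph) : digraph :=
  @Digraph (fvert D) (walk D) (@wsrc D) (@wtgt D).

(** ** The functor extending a homomorphism D1 -> Walks(D2) *)

Section Extension.
Variables (D1 D2 : finDigraph) (phi : hom D1 (Walks D2)).

Let flat (s : seq (fedge D1)) : seq (fedge D2) :=
  flatten [seq wedges (hE phi e : walk D2) | e <- s].

Lemma ext_walk_aux (v : fvert D1) (s : seq (fedge D1)) : is_walk v s ->
  is_walk (hV phi v : fvert D2) (flat s) /\
  last (hV phi v : fvert D2) (map (@ftgt D2) (flat s)) =
    hV phi (last v (map (@ftgt D1) s)).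
Proof.
elim: s v => [|e s IH] v //= /andP[/eqP <- /IH [w1 w2]].
have := hom_src phi e; have := hom_tgt phi e => /= ht hs.
rewrite /flat /= is_walk_cat map_cat last_cat -hs (valP (hE phi e : walk D2)) /=.
by rewrite -/(wtgt (hE phi e : walk D2)) ht.
Qed.

Definition ext_walk (p : walk D1) : walk D2 :=
  exist _ (hV phi (wsrc p), flat (wedges p)) (ext_walk_aux (valP p)).1.

Lemma ext_walk_tgt p : wtgt (ext_walk p) = hV phi (wtgt p).
Proof. exact: (ext_walk_aux (valP p)).2. Qed.

(** [ext_walk] is a functor that agrees with [phi] on walks of length 1; these
    properties determine it. *)

Lemma ext_walk_id v : ext_walk (walk_id v) = walk_id (hV phi v : fvert D2).
Proof. exact: val_inj. Qed.

Lemma ext_walk_comp p q (h : wtgt p = wsrc q)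
    (h' : wtgt (ext_walk p) = wsrc (ext_walk q)) :
  ext_walk (walk_comp h) = walk_comp h'.
Proof. by apply: val_inj; rewrite /= /flat map_cat flatten_cat. Qed.

Lemma ext_walk_edge e : ext_walk (walk_edge e) = hE phi e.
Proof.
apply: val_inj; rewrite /= /flat /= cats0 -(hom_src phi e) /=.
by case: (hE phi e) => -[].
Qed.

End Extension.

(** * Generalised bi-infinite walks and routes *)

Definition gwalk (D : finDigraph) : Type := hom Zline (Walks D).

Section Route.
Variable D : finDigraph.
Implicit Types w : gwalk D.

(** The length of the finite walk (z, z+1)w_E. *)
Definition glen w (z : int) : nat := wlen (hE w z : walk D).

Definition degenerate w : Prop :=
  (exists N : int, forall n : int, N <= n -> glen w n = 0%N) \/
  (exists N : int, forall n : int, n <= N -> glen w n = 0%N).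

Definition flattening w (w0 : hom Zline D) : Prop :=
  exists f : int -> int, forall z : int,
    f (z + 1) = f z + (glen w z)%:Z /\
    forall j : nat, (j < glen w z)%N ->
      onth (wedges (hE w z : walk D)) j = Some (hE w0 (f z + j%:Z)).

Definition route_class w : set (gwalk D) :=
  [set w' | ~ degenerate w' /\ flattening w' = flattening w :> set _].

Definition route : Type :=
  {A : set (gwalk D) | exists2 w, ~ degenerate w & A = route_class w}.

Definition route_of w (hw : ~ degenerate w) : route :=
  exist _ (route_class w) (ex_intro2 _ _ w hw erefl).

End Route.

(** * The maps induced on routes *)

Section Induced.
Variables D1 D2 : finDigraph.

(** The composite of the generalised walk [p] with the extension of [phi]. *)
Definition gwalk_comp (p : gwalk D1) (phi : hom D1 (Walks D2)) : gwalk D2.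
Proof.
refine (@Hom Zline (Walks D2) (fun z => hV phi (hV p z))
  (fun z => ext_walk phi (hE p z)) _ _).
- by move=> z /=; rewrite -(hom_src p z).
- by move=> z /=; rewrite ext_walk_tgt -(hom_tgt p z).
Defined.

Definition nondegenerate (phi : hom D1 (Walks D2)) : Prop :=
  forall p : gwalk D1, ~ degenerate p -> ~ degenerate (gwalk_comp p phi).

(** [f] is the map phi_* sending [p] to [p o phi~]. There is at most one such
    [f], since every route is of the form [route_of hp]. *)
Definition is_star (phi : hom D1 (Walks D2)) (nd : nondegenerate phi)
    (f : route D1 -> route D2) : Prop :=
  forall (p : gwalk D1) (hp : ~ degenerate p),
    f (route_of hp) = route_of (nd p hp).

End Induced.

(** * UDAF digraphs and strong UDAF equivalence *)

Definition is_UDAF (D : finDigraph) : Prop :=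
  forall v : fvert D,
    ~ (exists! h : hom Zge0 D, hV h 0%N = v) /\
    ~ (exists! h : hom Zle0 D, hV h 0%N = v).

(** The morphisms of UDAFG; an object (Route(D), D) is given by D. *)
Inductive UDAFG : forall D1 D2 : finDigraph, (route D1 -> route D2) -> Prop :=
| UDAFG_folding (D1 D2 : finDigraph) (phi : hom D1 (Walks D2)) (nd : nondegenerate phi)
    (f : route D1 -> route D2) :
    is_UDAF D1 -> is_UDAF D2 -> is_star nd f -> bijective f -> UDAFG f
| UDAFG_id (D : finDigraph) : is_UDAF D -> @UDAFG D D id
| UDAFG_comp (D1 D2 D3 : finDigraph) (f : route D1 -> route D2) (g : route D2 -> route D3) :
    UDAFG f -> UDAFG g -> UDAFG (g \o f)
| UDAFG_inv (D1 D2 : finDigraph) (f : route D1 -> route D2) (g : route D2 -> route D1) :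
    UDAFG f -> cancel f g -> cancel g f -> UDAFG g.

Definition strong_UDAF_equivalent (D1 D2 : finDigraph) : Prop :=
  is_UDAF D1 /\ is_UDAF D2 /\
  exists (f : route D1 -> route D2) (g : route D2 -> route D1),
    UDAFG f /\ UDAFG g /\ g \o f = id /\ f \o g = id.

(** * Shift equivalence *)

Section DimensionTriple.
Variable D : finDigraph.

Definition Adj : 'M[rat]_#|fvert D| :=
  \matrix_(i, j)
    #|[set e : fedge D | fsrc e == enum_val i & ftgt e == enum_val j]%SET|%:R.

Definition eventual_range : set 'rV[rat]_#|fvert D| :=
  \bigcap_(i in [set: nat]) range (fun v : 'rV[rat]_#|fvert D| => v *m Adj ^+ i).

Definition dim_group : set 'rV[rat]_#|fvert D| :=
  [set v | exists i : nat, forall j, (v *m Adj ^+ i) 0 j \is a Num.int]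
  `&` eventual_range.

Definition dim_group_pos : set 'rV[rat]_#|fvert D| :=
  [set v | exists i : nat, forall j, (v *m Adj ^+ i) 0 j \is a Num.nat]
  `&` eventual_range.

End DimensionTriple.

Arguments eventual_range : clear implicits.
Arguments dim_group : clear implicits.
Arguments dim_group_pos : clear implicits.

(** The values of [f] outside [dim_group D1] are irrelevant. *)
Definition shift_equivalent (D1 D2 : finDigraph) : Prop :=
  exists f : 'rV[rat]_#|fvert D1| -> 'rV[rat]_#|fvert D2|,
    [/\ set_bij (dim_group D1) (dim_group D2) f,
        forall x y, dim_group D1 x -> dim_group D1 y -> f (x + y) = f x + f y,
        f @` dim_group_pos D1 = dim_group_pos D2
      & forall x, dim_group D1 x -> f (x *m Adj D1) = f x *m Adj D2].

(** * The two digraphs *)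

Definition R2 : finDigraph :=
  @FinDigraph unit bool (fun=> tt) (fun=> tt).

Inductive gm_vertex := gm_u | gm_v.
Inductive gm_edge := gm_a | gm_b | gm_c.

Definition gm_vertex_code (x : gm_vertex) : bool :=
  if x is gm_u then false else true.
Definition gm_vertex_decode (b : bool) : gm_vertex := if b then gm_v else gm_u.
Lemma gm_vertex_codeK : cancel gm_vertex_code gm_vertex_decode.
Proof. by case. Qed.
HB.instance Definition _ := Finite.copy gm_vertex (can_type gm_vertex_codeK).

Definition gm_edge_code (x : gm_edge) : option bool :=
  match x with gm_a => None | gm_b => Some false | gm_c => Some true end.
Definition gm_edge_decode (o : option bool) : gm_edge :=
  match o with None => gm_a | Some false => gm_b | Some true => gm_c end.
Lemma gm_edge_codeK : cancel gm_edge_code gm_edge_decode.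
Proof. by case. Qed.
HB.instance Definition _ := Finite.copy gm_edge (can_type gm_edge_codeK).

Definition golden_mean : finDigraph :=
  @FinDigraph gm_vertex gm_edge
    (fun e => match e with gm_a | gm_b => gm_u | gm_c => gm_v end)
    (fun e => match e with gm_a | gm_c => gm_u | gm_b => gm_v end).

(* Main.v *)
From mathcomp Require Import all_boot all_order all_algebra.
From mathcomp Require Import boolp classical_sets.
From mathcomp Require Import zify lra.
Require Import Defs.

Set Implicit Arguments.
Unset Strict Implicit.
Unset Printing Implicit Defensive.

Import Order.TTheory GRing.Theory Num.Theory.
Local Open Scope ring_scope.

(** Read a bi-infinite walk of the golden mean graph as a sequence over the two blocks
    [gm_a] and [gm_b gm_c], the only first-return walks at [gm_u].  Naming these blocks
    [false] and [true] gives a bi-infinite word over two letters, that is a walk of the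
    rose, and every word arises from exactly one walk up to translation.  So the
    substitution [rose_to_gm], [false] to [gm_a] and [true] to [gm_b gm_c], is a UDAF
    folding.  Its inverse on routes is induced by [gm_to_rose], which sends [gm_a] and
    [gm_b] to the two loops and erases [gm_c]; it is non-degenerate because two edges
    [gm_c] are never adjacent.

    Both composites are handled through flattenings.  A non-degenerate generalised walk
    has a flattening ([flattening_exists]), two of its flattenings differ by a
    translation ([flattening_translate]), and therefore two generalised walks with one
    common flattening define the same route ([route_of_common]).  Hence each route is
    that of an ordinary bi-infinite walk x ([route_line]), and it is enough to check that
    x is still a flattening of its image under the two substitutions
    ([rose_gm_rose_flattening], [gm_rose_gm_flattening]).

    For the second half: the adjacency matrix of the rose is the 1 x 1 matrix 2, so its
    shift automorphism is doubling, a property that any isomorphism of dimension triples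
    preserves.  As 2 is not an eigenvalue of the adjacency matrix of the golden mean
    graph, the dimension group of that graph would have to vanish, whereas that of the
    rose contains 0 and 1. *)

(** * Flattenings of generalised walks *)

(** The functions that witness a flattening: the block of index z occupies the positions
    from [f z] up to, but excluding, [f z + len z]. *)
Definition positions (len : int -> nat) (f : int -> int) : Prop :=
  forall z, f (z + 1) = f z + (len z)%:Z.

Lemma positions_exist (len : int -> nat) : exists f, positions len f.
Proof.
exists (fun z : int => match z with
  | Posz n => \sum_(i < n) (len i%:Z)%:Z
  | Negz n => - \sum_(i < n.+1) (len (Negz i))%:Z end) => -[n|[|n]].
- by rewrite (_ : Posz n + 1 = Posz n.+1) ?big_ord_recr //=; lia.
- by rewrite (_ : Negz 0 + 1 = Posz 0) // big_ord0 big_ord1 addNr.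
- rewrite (_ : Negz n.+1 + 1 = Negz n); last by lia.
  by rewrite [in RHS]big_ord_recr /= opprD addrNK.
Qed.

Lemma positions_le len f : positions len f -> forall z (k : nat), f z <= f (z + k%:Z).
Proof.
move=> pf z; elim=> [|k IH]; first by rewrite addr0.
rewrite (_ : z + k.+1%:Z = z + k%:Z + 1); last by lia.
by rewrite pf (le_trans IH) // lerDl.
Qed.

Lemma positions_mono len f : positions len f -> {homo f : x y / x <= y}.
Proof.
move=> pf x y xy; have := positions_le pf x `|y - x|%N.
by rewrite (_ : x + `|y - x|%N = y) //; lia.
Qed.

Lemma positions_lt len f : positions len f -> forall x y, x < y -> f x + (len x)%:Z <= f y.
Proof. by move=> pf x y xy; rewrite -pf; apply: (positions_mono pf); lia. Qed.

Lemma nondegenerateP (D : finDigraph) (w : gwalk D) : ~ degenerate w <->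
  (forall N : int, exists2 n : int, N <= n & glen w n != 0%N) /\
  (forall N : int, exists2 n : int, n <= N & glen w n != 0%N).
Proof.
split=> [h|[hr hl] [[N hN]|[N hN]]].
- split=> N; apply: contrapT => nex; apply: h; [left|right]; exists N => n nN;
    by apply/eqP; apply: contrapT => /negP ne; apply: nex; exists n.
- by have [n nN /eqP] := hr N; apply; apply: hN.
- by have [n nN /eqP] := hl N; apply; apply: hN.
Qed.

Section Cover.
Variables (D : finDigraph) (w : gwalk D) (f : int -> int).
Hypotheses (nd : ~ degenerate w) (pf : positions (glen w) f).

Lemma positions_unbounded_above (k : nat) z : exists n : nat, f z + k%:Z <= f (z + n%:Z).
Proof.
elim: k => [|k [n IH]]; first by exists 0%N; rewrite !addr0.
have [/(_ (z + n%:Z))[m mN l0] _] := (nondegenerateP w).1 nd.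
exists (`|m - z|.+1)%N; rewrite (_ : z + _ = m + 1) ?pf; last by lia.
by have := positions_mono pf mN; lia.
Qed.

Lemma positions_unbounded_below (k : nat) z : exists2 y : int, y <= z & f y <= f z - k%:Z.
Proof.
elim: k => [|k [y yz IH]]; first by exists z; rewrite ?subr0.
have [_ /(_ (y - 1))[m my l0]] := (nondegenerateP w).1 nd.
exists m; first by lia.
have: f (m + 1) <= f y by apply: (positions_mono pf); lia.
by rewrite pf; lia.
Qed.

(** Positions are unbounded in both directions, so the blocks tile the integers: the block
    containing m is the one before the first block that starts beyond m. *)
Lemma positions_cover m : exists z (j : nat), (j < glen w z)%N /\ m = f z + j%:Z.
Proof.
have [y _ fy] := positions_unbounded_below `|m - f 0| 0.
have y_le : f y <= m by lia.
have ex : exists n : nat, m < f (y + n%:Z).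
  have [n fn] := positions_unbounded_above `|m - f y|.+1 y; exists n; lia.
case: (ex_minnP ex) => -[|n] mn minn; first by rewrite addr0 in mn; lia.
have le : f (y + n%:Z) <= m.
  by rewrite leNgt; apply/negP => /minn; rewrite ltnn.
rewrite (_ : y + n.+1%:Z = y + n%:Z + 1) in mn; last by lia.
move: (y + n%:Z) mn le => z; rewrite pf => mn le.
by exists z, `|m - f z|%N; lia.
Qed.

End Cover.

Section WalkEdges.
Variable D : finDigraph.
Implicit Types (v : fvert D) (s : seq (fedge D)) (e : fedge D).

Lemma is_walk_first v s e : is_walk v s -> onth s 0 = Some e -> fsrc e = v.
Proof. by case: s => [|a s] //= /andP[/eqP <- _] [->]. Qed.

Lemma is_walk_last v s e j : onth s j = Some e -> j.+1 = size s ->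
  ftgt e = last v (map (@ftgt D) s).
Proof.
elim: s v j => [|a s IH] v [|j] //=; last by move=> oe [] /(IH (ftgt a) _ oe).
by case: s {IH} => //= -[->].
Qed.

Lemma is_walk_next v s e e' j : is_walk v s ->
  onth s j = Some e -> onth s j.+1 = Some e' -> ftgt e = fsrc e'.
Proof.
elim: s v j => [|a s IH] v j //= /andP[_ ws].
case: j => [|j] /=; last exact: (IH (ftgt a)).
by move=> -[<-] /(is_walk_first ws).
Qed.

End WalkEdges.

Lemma wsrc_wtgt (D : finDigraph) (p : walk D) : wlen p = 0%N -> wtgt p = wsrc p.
Proof. by rewrite /wtgt /wlen; case: (wedges p). Qed.

Section Flattening.
Variable D : finDigraph.
Implicit Types (w : gwalk D) (x y : hom Zline D).

Lemma gwalk_silent_vertex w z (k : nat) :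
  (forall i : nat, (i < k)%N -> glen w (z + i%:Z) = 0%N) -> hV w (z + k%:Z) = hV w z.
Proof.
elim: k => [|k IH] h; first by rewrite addr0.
rewrite -[RHS]IH => [|i ik]; last by apply: h; lia.
rewrite (_ : z + k.+1%:Z = z + k%:Z + 1); last by lia.
rewrite -[LHS](hom_tgt w) -[RHS](hom_src w).
by apply: wsrc_wtgt; apply: h.
Qed.

(** Two edges at consecutive positions lie either in the same finite walk or at the
    junction of two walks that are separated only by walks of length zero. *)
Lemma flat_edges_adjacent w f : positions (glen w) f ->
  forall (z : int) j e (z' : int) j' e',
  onth (wedges (hE w z : walk D)) j = Some e ->
  onth (wedges (hE w z' : walk D)) j' = Some e' ->
  f z + j%:Z + 1 = f z' + j'%:Z -> ftgt e = fsrc e'.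
Proof.
move=> pf z j e z' j' e' oe oe' eq.
have jlt : (j < glen w z)%N by rewrite /glen /wlen -onthTE oe.
have jlt' : (j' < glen w z')%N by rewrite /glen /wlen -onthTE oe'.
have [ez|ne] := eqVneq z z'.
  move: oe'; rewrite -ez (_ : j' = j.+1) => [oe'|]; last by subst; lia.
  exact: (is_walk_next (valP (hE w z : walk D)) oe oe').
have fz := pf z; have fz' := pf z'.
have zz' : z + 1 <= z'.
  have [|lt|ez] := ltgtP z z'; first by lia.
    by have := positions_lt pf lt; lia.
  by rewrite ez eqxx in ne.
have le := positions_mono pf zz'; rewrite fz in le.
have j'0 : j' = 0%N by lia.
have jl : j.+1 = glen w z by lia.
rewrite (is_walk_last (wsrc (hE w z : walk D)) oe jl).
rewrite j'0 in oe'; rewrite (is_walk_first (valP (hE w z' : walk D)) oe').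
have -> : (sval (hE w z' : walk D)).1 = hV w z' := hom_src w z'.
rewrite (_ : last _ _ = hV w (z + 1)); last exact: (hom_tgt w z).
have [k ek] : exists k : nat, z' = z + 1 + k%:Z.
  by exists (absz (z' - (z + 1))%R); lia.
rewrite ek gwalk_silent_vertex // => i ilt.
have lt1 : z + 1 + i%:Z < z' by lia.
have l1 : z + 1 <= z + 1 + i%:Z by lia.
by have := positions_mono pf l1; rewrite fz; have := positions_lt pf lt1; lia.
Qed.

(** Each position lies in a block and thus carries an edge of [w]; the block is unique
    because empty blocks contain no position. *)
Lemma flattening_exists w : ~ degenerate w -> exists x, flattening w x.
Proof.
move=> nd; have [f pf] := positions_exist (glen w).
have /choice[E hE'] m : exists e, exists z (j : nat), m = f z + j%:Z /\
    onth (wedges (hE w z : walk D)) j = Some e.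
  have [z [j [jlt ->]]] := positions_cover nd pf m.
  move: jlt; rewrite /glen /wlen -onthTE.
  by case oe: onth => [e|] // _; exists e, z, j.
have adj m : ftgt (E m) = fsrc (E (m + 1)).
  have [z [j [em oe]]] := hE' m; have [z' [j' [em' oe']]] := hE' (m + 1).
  by apply: (flat_edges_adjacent pf oe oe'); rewrite -em.
exists (@Hom Zline D (fun m => fsrc (E m)) E (fun=> erefl) adj), f => z.
split; first exact: pf.
move=> j jlt; have [z' [j' [em oe]]] := hE' (f z + j%:Z).
have jlt' : (j' < glen w z')%N by rewrite /glen /wlen -onthTE oe.
have ez : z = z'.
  have fz := pf z; have fz' := pf z'.
  have [lt|lt|//] := ltgtP z z'.
  - by have := positions_lt pf lt; lia.
  - by have := positions_lt pf lt; lia.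
by rewrite /= -oe -ez; congr onth; subst z'; lia.
Qed.

(** Position functions with the same increments differ by a constant, so two
    flattenings of a non-degenerate walk are translates of each other. *)
Lemma flattening_translate w x y : ~ degenerate w -> flattening w x -> flattening w y ->
  exists c, forall m, hE y (m + c) = hE x m.
Proof.
move=> nd [f hf] [g hg].
have pf : positions (glen w) f by move=> z; have [] := hf z.
have diff z : g z - f z = g 0 - f 0.
  have step u : g (u + 1) - f (u + 1) = g u - f u.
    by have [-> _] := hf u; have [-> _] := hg u; lia.
  have up u (k : nat) : g (u + k%:Z) - f (u + k%:Z) = g u - f u.
    elim: k => [|k IH]; first by rewrite addr0.
    by rewrite -IH -(step (u + k%:Z)); congr (g _ - f _); lia.
  have [z0|z0] := leP 0 z.
    by rewrite -(up 0 `|z|%N); congr (g _ - f _); lia.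
  by rewrite -(up z `|z|%N); congr (g _ - f _); lia.
exists (g 0 - f 0) => m.
have [z [j [jlt ->]]] := positions_cover nd pf m.
have [_ /(_ _ jlt) ox] := hf z; have [_ /(_ _ jlt) oy] := hg z.
move: oy; rewrite ox => -[->]; congr (hE y _).
by have := diff z; lia.
Qed.

Lemma flattening_translated w x y c : flattening w x ->
  (forall m, hE y (m + c) = hE x m) -> flattening w y.
Proof.
move=> [f hf] xy; exists (fun z => f z + c) => z; have [h1 h2] := hf z.
split; first by rewrite h1 addrAC.
by move=> j /h2 ->; rewrite -xy; congr (Some (hE y _)); lia.
Qed.

Lemma flattening_common w w' x : ~ degenerate w -> ~ degenerate w' ->
  flattening w x -> flattening w' x -> flattening w = flattening w'.
Proof.
move=> nd nd' fx fx'; apply/funext => y; apply/propext; split=> fy.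
- have [c cE] := flattening_translate nd fx fy.
  exact: flattening_translated fx' cE.
- have [c cE] := flattening_translate nd' fx' fy.
  exact: flattening_translated fx cE.
Qed.

Lemma route_of_common w w' (nd : ~ degenerate w) (nd' : ~ degenerate w') x :
  flattening w x -> flattening w' x -> route_of nd = route_of nd'.
Proof.
move=> fx fx'; apply: eq_exist.
by rewrite /route_class (flattening_common nd nd' fx fx').
Qed.

Lemma route_of_inj w w' (nd : ~ degenerate w) (nd' : ~ degenerate w') :
  route_of nd = route_of nd' -> flattening w = flattening w'.
Proof.
move=> /(congr1 sval) /= e.
have: route_class w w by split.
by rewrite e => -[].
Qed.

Definition line_gwalk x : gwalk D :=
  @Hom Zline (Walks D) (hV x) (fun z => walk_edge (hE x z))
    (hom_src x) (hom_tgt x).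

Lemma line_nondegenerate x : ~ degenerate (line_gwalk x).
Proof. by apply/nondegenerateP; split=> N; exists N. Qed.

Lemma line_flattening x : flattening (line_gwalk x) x.
Proof. by exists id => z; split=> // -[|//] _; rewrite addr0. Qed.

Lemma route_surj (r : route D) : exists w (nd : ~ degenerate w), r = route_of nd.
Proof. by case: r => A [w nd eA]; exists w, nd; apply: eq_exist. Qed.

Lemma route_line (r : route D) : exists x, r = route_of (@line_nondegenerate x).
Proof.
have [w [nd ->]] := route_surj r; have [x fx] := flattening_exists nd.
by exists x; apply: (route_of_common _ _ fx); apply: line_flattening.
Qed.

End Flattening.

(** * Maps induced on routes *)

Section Star.
Variables (D1 D2 : finDigraph) (phi : hom D1 (Walks D2)).

Lemma wedges_ext (p : walk D1) :
  wedges (ext_walk phi p) = flatten [seq wedges (hE phi e : walk D2) | e <- wedges p].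
Proof. by []. Qed.

(** Flattening first and substituting afterwards amounts to composing the two
    position functions. *)
Lemma flattening_comp (w : gwalk D1) x y : flattening w x ->
  flattening (gwalk_comp (line_gwalk x) phi) y -> flattening (gwalk_comp w phi) y.
Proof.
move=> [f hf] [g hg]; exists (fun z => g (f z)) => z.
have [-> hx] := hf z; rewrite /glen /wlen /= in hx *.
rewrite wedges_ext; elim: (wedges _) (f z) hx => [|e s IH] m hx.
  by split=> //; rewrite !addr0.
have [] := hx 0%N isT; rewrite addr0 => ee.
have [gm gE] := hg m; rewrite /glen /wlen /= wedges_ext /= cats0 -ee in gm gE.
have [|gs sE] := IH (m + 1).
  by move=> j js; rewrite -[onth s j]/(onth (e :: s) j.+1) hx //; congr (Some (hE x _)); lia.
rewrite /= size_cat; split.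
  rewrite (_ : m + (size s).+1%:Z = m + 1 + (size s)%:Z); last by lia.
  by rewrite gs gm PoszD addrA.
move=> j jlt; rewrite onth_cat; case: ltnP => jl; first exact: gE.
by rewrite sE ?gm -?addrA -?PoszD ?subnKC // ltn_subLR.
Qed.

(** If [x] is a common flattening of [p] and [p'], then any flattening of the image of [x]
    is a common flattening of their images. *)
Lemma star_well_defined (nd : nondegenerate phi) (p p' : gwalk D1)
    (hp : ~ degenerate p) (hp' : ~ degenerate p') :
  route_of hp = route_of hp' -> route_of (nd _ hp) = route_of (nd _ hp').
Proof.
move=> /route_of_inj e; have [x fx] := flattening_exists hp.
have [y fy] := flattening_exists (nd _ (@line_nondegenerate _ x)).
by apply: (@route_of_common _ _ _ _ _ y); apply: flattening_comp fy; rewrite -?e.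
Qed.

Lemma star_exists (nd : nondegenerate phi) : exists f, is_star nd f.
Proof.
have /choice[f hf] (r : route D1) : exists r', exists p (hp : ~ degenerate p),
    r = route_of hp /\ r' = route_of (nd p hp).
  by have [p [hp ->]] := route_surj r; exists (route_of (nd p hp)), p, hp.
exists f => p hp; have [p' [hp' [e ->]]] := hf (route_of hp).
exact: star_well_defined.
Qed.

End Star.

(** * The two substitutions between the rose and the golden mean graph *)

Lemma bc_is_walk : @is_walk golden_mean gm_u [:: gm_b; gm_c].
Proof. by []. Qed.

Definition bc_walk : walk golden_mean := exist _ (gm_u, [:: gm_b; gm_c]) bc_is_walk.

Definition rose_to_gm : hom R2 (Walks golden_mean).
Proof.
refine (@Hom R2 (Walks golden_mean) (fun=> gm_u)
  (fun e : bool => if e then bc_walk else @walk_edge golden_mean gm_a) _ _);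
by case.
Defined.

Definition gm_to_rose : hom golden_mean (Walks R2).
Proof.
refine (@Hom golden_mean (Walks R2) (fun=> tt)
  (fun e : gm_edge => match e with
     | gm_a => @walk_edge R2 false
     | gm_b => @walk_edge R2 true
     | gm_c => @walk_id R2 tt end) _ _);
by case.
Defined.

Lemma rose_to_gm_nondegenerate : nondegenerate rose_to_gm.
Proof.
move=> p /nondegenerateP[hr hl]; apply/nondegenerateP.
have lenE n : glen p n != 0%N -> glen (gwalk_comp p rose_to_gm) n != 0%N.
  by rewrite /glen /wlen /= wedges_ext; case: (wedges _) => [|[] s].
by split=> N; [have [n nN l] := hr N|have [n nN l] := hl N]; exists n => //; apply: lenE.
Qed.

Lemma gm_to_rose_silent (p : walk golden_mean) : wlen (ext_walk gm_to_rose p) = 0%N ->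
  wlen p = 0%N \/ wsrc p = gm_v /\ wtgt p = gm_u.
Proof.
case: p => -[v [|e s]] /= wp; first by left.
rewrite /wlen /wtgt /wsrc /wedges /=; case: e wp => //= /andP[/eqP <- wp] l0; right.
by case: s wp l0 => [|[] s].
Qed.

(** A walk that is sent to an empty walk is empty or the edge from [gm_v] to [gm_u];
    as no such edge starts at [gm_u] or ends at [gm_v], in a sequence of such walks
    at most one is non-empty. *)
Lemma gm_to_rose_nondegenerate : nondegenerate gm_to_rose.
Proof.
move=> p nd; have [hr hl] := (nondegenerateP p).1 nd.
have sE z : wsrc (hE p z : walk golden_mean) = hV p z := hom_src p z.
have tE z : wtgt (hE p z : walk golden_mean) = hV p (z + 1) := hom_tgt p z.
case=> -[N hN]; apply: nd.
- have [n nN ln] := hr N.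
  have uV (k : nat) : hV p (n + 1 + k%:Z) = gm_u.
    elim: k => [|k IH].
      case: (gm_to_rose_silent (hN n nN)) => [l0|[_]]; last by rewrite tE addr0.
      by rewrite /glen l0 in ln.
    have [|l0|[]] := gm_to_rose_silent (hN (n + 1 + k%:Z) _); first by lia.
    + have := wsrc_wtgt l0; rewrite sE tE IH => <-.
      by congr (hV p _); lia.
    + by rewrite sE IH.
  left; exists (n + 1) => m nm.
  have [|//|[]] := gm_to_rose_silent (hN m _); first by lia.
  have -> : m = n + 1 + (absz (m - (n + 1))%R)%:Z by lia.
  by rewrite sE uV.
- have [n nN ln] := hl N.
  have vV (k : nat) : hV p (n - k%:Z) = gm_v.
    elim: k => [|k IH].
      case: (gm_to_rose_silent (hN n nN)) => [l0|[]]; last by rewrite sE subr0.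
      by rewrite /glen l0 in ln.
    have eV : n - k.+1%:Z + 1 = n - k%:Z by lia.
    have [|l0|[]] := gm_to_rose_silent (hN (n - k.+1%:Z) _); first by lia.
    + by have := wsrc_wtgt l0; rewrite sE tE eV IH => ->.
    + by rewrite tE eV IH.
  right; exists (n - 1) => m nm.
  have [|//|[]] := gm_to_rose_silent (hN m _); first by lia.
  rewrite tE (_ : m + 1 = n - (absz (n - (m + 1))%R)%:Z); last by lia.
  by rewrite vV.
Qed.

Lemma rose_gm_rose_flattening (x : hom Zline R2) :
  flattening (gwalk_comp (gwalk_comp (line_gwalk x) rose_to_gm) gm_to_rose) x.
Proof.
exists id => z; rewrite /glen /wlen /=.
by case ex: (hE x z) => /=; split=> // -[|//] _ /=; rewrite addr0 ex.
Qed.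

(** Replacing each [gm_b] by the walk [gm_b gm_c] and deleting each [gm_c] only moves
    the edges leaving [gm_v] into the preceding block, so that the block at such an
    edge starts one position later. *)
Lemma gm_rose_gm_flattening (x : hom Zline golden_mean) :
  flattening (gwalk_comp (gwalk_comp (line_gwalk x) gm_to_rose) rose_to_gm) x.
Proof.
exists (fun z => z + (if hV x z is gm_v then 1 else 0)) => z; rewrite /glen /wlen /=.
have := hom_src x z; have := hom_tgt x z; have := hom_src x (z + 1).
case ex: (hE x z) => /= sx' <- <-; split; try lia; case=> [|[|j]] // _ /=; rewrite ?addr0.
- by rewrite ex.
- by rewrite ex.
- by congr Some; move: sx'; rewrite -(hom_tgt x) /= ex; case: (hE x _).
Qed.

(** * Uniqueness of half-infinite walks *)

Lemma not_unique_ray (D : finDigraph) (s s' : nat -> fedge D) :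
  (forall i, ftgt (s i) = fsrc (s i.+1)) -> (forall i, ftgt (s' i) = fsrc (s' i.+1)) ->
  fsrc (s 0%N) = fsrc (s' 0%N) -> (exists i, s i != s' i) ->
  ~ exists! h : hom Zge0 D, hV h 0%N = fsrc (s 0%N).
Proof.
move=> ps ps' e [i ne] [h [_ uniq]].
have e1 := uniq (@Hom Zge0 D (fun i => fsrc (s i)) s (fun=> erefl) ps) erefl.
have e2 := uniq (@Hom Zge0 D (fun i => fsrc (s' i)) s' (fun=> erefl) ps') (esym e).
by move: e1; rewrite e2 => /(congr1 (@hE _ _)) /(congr1 (@^~ i)) /= ei; rewrite ei eqxx in ne.
Qed.

Lemma not_unique_coray (D : finDigraph) (s s' : nat -> fedge D) :
  (forall i, fsrc (s i) = ftgt (s i.+1)) -> (forall i, fsrc (s' i) = ftgt (s' i.+1)) ->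
  ftgt (s 0%N) = ftgt (s' 0%N) -> (exists i, s i != s' i) ->
  ~ exists! h : hom Zle0 D, hV h 0%N = ftgt (s 0%N).
Proof.
move=> ps ps' e [i ne] [h [_ uniq]].
have e1 := uniq (@Hom Zle0 D (fun i => ftgt (s i)) s ps (fun=> erefl)) erefl.
have e2 := uniq (@Hom Zle0 D (fun i => ftgt (s' i)) s' ps' (fun=> erefl)) (esym e).
by move: e1; rewrite e2 => /(congr1 (@hE _ _)) /(congr1 (@^~ i)) /= ei; rewrite ei eqxx in ne.
Qed.

Lemma rose_is_UDAF : is_UDAF R2.
Proof.
case; split.
- by apply: (@not_unique_ray R2 (fun=> true) (fun=> false)) => //; exists 0%N.
- by apply: (@not_unique_coray R2 (fun=> true) (fun=> false)) => //; exists 0%N.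
Qed.

Lemma golden_mean_is_UDAF : is_UDAF golden_mean.
Proof.
(* At [gm_u], a constant walk and one alternating between [gm_b] and [gm_c]; at [gm_v],
   the same two after one more edge.  Backward walks are listed from their last edge. *)
pose bc i := if odd i then gm_c else gm_b; pose cb i := if odd i then gm_b else gm_c.
pose cons e (s : nat -> gm_edge) i := if i is j.+1 then s j else e.
pose a_ (i : nat) := gm_a.
case; split.
- apply: (@not_unique_ray golden_mean a_ bc) => //; last by exists 0%N.
  by move=> i; rewrite /bc /=; case: odd.
- apply: (@not_unique_coray golden_mean a_ cb) => //; last by exists 0%N.
  by move=> i; rewrite /cb /=; case: odd.
- apply: (@not_unique_ray golden_mean (cons gm_c a_) (cons gm_c bc)) => //; first by case.
    by case=> // i; rewrite /bc /=; case: odd.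
  by exists 1%N.
- apply: (@not_unique_coray golden_mean (cons gm_b a_) (cons gm_b cb)) => //; first by case.
    by case=> // i; rewrite /cb /=; case: odd.
  by exists 1%N.
Qed.

(** * Strong UDAF equivalence *)

Lemma rose_gm_strong_UDAF : strong_UDAF_equivalent R2 golden_mean.
Proof.
have [f hf] := star_exists rose_to_gm_nondegenerate.
have [g hg] := star_exists gm_to_rose_nondegenerate.
have gf : cancel f g.
  move=> r; have [x ->] := route_line r; rewrite hf hg.
  exact: route_of_common (rose_gm_rose_flattening x) (line_flattening x).
have fg : cancel g f.
  move=> r; have [x ->] := route_line r; rewrite hg hf.
  exact: route_of_common (gm_rose_gm_flattening x) (line_flattening x).
have Uf : UDAFG f.
  by apply: UDAFG_folding hf _; [exact: rose_is_UDAF | exact: golden_mean_is_UDAF | exists g].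
split; first exact: rose_is_UDAF.
split; first exact: golden_mean_is_UDAF.
exists f, g; split=> //; split; first exact: UDAFG_inv Uf gf fg.
by split; apply/funext.
Qed.

(** * Shift inequivalence *)

Lemma mul_AdjE (D : finDigraph) (y : 'rV_#|fvert D|) (x : fvert D) :
  (y *m Adj D) 0 (enum_rank x) = \sum_(v : fvert D)
    y 0 (enum_rank v) * #|[set e : fedge D | fsrc e == v & ftgt e == x]%SET|%:R.
Proof.
rewrite mxE (reindex (@enum_rank (fvert D))) /=; last exact: onW_bij (@enum_rank_bij _).
by apply: eq_bigr => v _; rewrite mxE !enum_rankK.
Qed.

Lemma Adj_rose (y : 'rV_#|fvert R2|) : y *m Adj R2 = y + y.
Proof.
have card2 v : #|[set e : fedge R2 | fsrc e == tt & ftgt e == v]%SET| = 2%N.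
  by apply: etrans card_bool; apply: (@eq_card bool) => e; rewrite !inE; case: v.
apply/rowP => j; rewrite -(enum_valK j) mul_AdjE mxE (big_pred1 tt) => [|[] //].
by rewrite card2 mulr_natr mulr2n; case: (enum_val j : unit).
Qed.

(** In coordinates the hypothesis says u + v = 2u and u = 2v. *)
Lemma golden_mean_doubling_eq0 (y : 'rV_#|fvert golden_mean|) :
  y *m Adj golden_mean = y + y -> y = 0.
Proof.
move=> e.
have sumE (F : gm_vertex -> rat) : \sum_v F v = F gm_u + F gm_v.
  rewrite (reindex gm_vertex_decode) ?big_bool /= 1?addrC //.
  by exists gm_vertex_code => x _; [case: x | exact: gm_vertex_codeK].
have eu := @mul_AdjE golden_mean y gm_u; have ev := @mul_AdjE golden_mean y gm_v.
rewrite e mxE sumE in eu; rewrite e mxE sumE in ev.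
have card_uu : #|[set e : fedge golden_mean | fsrc e == gm_u & ftgt e == gm_u]%SET| = 1%N.
  by rewrite -(cards1 gm_a); apply: eq_card; case; rewrite !inE.
have card_vu : #|[set e : fedge golden_mean | fsrc e == gm_v & ftgt e == gm_u]%SET| = 1%N.
  by rewrite -(cards1 gm_c); apply: eq_card; case; rewrite !inE.
have card_uv : #|[set e : fedge golden_mean | fsrc e == gm_u & ftgt e == gm_v]%SET| = 1%N.
  by rewrite -(cards1 gm_b); apply: eq_card; case; rewrite !inE.
have card_vv : #|[set e : fedge golden_mean | fsrc e == gm_v & ftgt e == gm_v]%SET| = 0%N.
  by apply: eq_card0; case; rewrite !inE.
rewrite card_uu card_vu in eu; rewrite card_uv card_vv in ev.
have y0 : y 0 (enum_rank gm_u) = 0 /\ y 0 (enum_rank gm_v) = 0 by split; lra.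
by apply/rowP => j; rewrite -(enum_valK j) mxE; case: (enum_val j) y0 => -[].
Qed.

Lemma const_in_dim_group_rose (c : rat) : c \is a Num.int ->
  dim_group R2 (const_mx c).
Proof.
move=> cz; split; first by exists 0%N => j; rewrite expr0 mulmx1 mxE.
have pow i (y : 'rV_#|fvert R2|) : y *m Adj R2 ^+ i = 2 ^+ i *: y.
  elim: i => [|i IH]; first by rewrite expr0 mulmx1 scale1r.
  by rewrite exprSr mulmxA IH Adj_rose -scalerDl exprS mulr2n mulrDl mul1r.
move=> i _; exists ((2 ^+ i)^-1 *: const_mx c) => //.
by rewrite pow scalerA mulfV ?scale1r // expf_neq0.
Qed.

Lemma rose_gm_not_shift_equivalent : ~ shift_equivalent R2 golden_mean.
Proof.
move=> [f [[f_in f_inj _] f_add _ f_shift]].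
have f0 x : dim_group R2 x -> f x = 0.
  move=> gx; apply: golden_mean_doubling_eq0.
  by rewrite -f_shift // Adj_rose f_add.
have g0 := @const_in_dim_group_rose 0 isT; have g1 := @const_in_dim_group_rose 1 isT.
have /rowP : const_mx 0 = const_mx 1 :> 'rV[rat]_#|fvert R2|.
  by apply: f_inj; rewrite ?inE // !f0.
by move=> /(_ (enum_rank tt)); rewrite !mxE.
Qed.

Theorem mainTheorem10 :
  strong_UDAF_equivalent R2 golden_mean /\ ~ shift_equivalent R2 golden_mean.
Proof.
split; [exact: rose_gm_strong_UDAF | exact: rose_gm_not_shift_equivalent].
Qed.
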